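(* Let $\Sigma$ be an alphabet. Every regular language over $\Sigma$ is recognized by some finite automaton over $\Sigma$.
   Context: An automaton over $\Sigma$ is a (possibly infinite) $\Sigma$-labelled directed graph with a distinguished set of initial vertices and a distinguished set of accepting vertices; it is finite if it has finitely many vertices (states) and edges (transitions). There are no silent transitions. A word $w=w_1\cdots w_n$ ($n\ge 0$, $w_i\in\Sigma$) is recognized by an automaton $A$ if there is a path in $A$ labelled by $w$ from an initial state to an accepting state; the language recognized by $A$ is the set of words it recognizes. Regular languages are the languages generated by the empty language and the singleton languages $\{a\}$ for $a\in\Sigma$ under union, concatenation $L_1*L_2=\{w_1*w_2\mid w_1\in L_1,w_2\in L_2\}$, and Kleene star $L^*=\bigcup_{n\in\mathbb{N}}L^n$ (where $L^0$ consists of the empty word only). *)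

(* Defs.v *)
From mathcomp Require Import all_boot.
From mathcomp Require Import boolp classical_sets cardinality.

Set Implicit Arguments.
Unset Strict Implicit.
Unset Printing Implicit Defensive.

Local Open Scope classical_set_scope.

Section Languages.
Variable Sigma : Type.

Definition language := set (seq Sigma).

Definition lang_cat (L1 L2 : language) : language :=
  [set w1 ++ w2 | w1 in L1 & w2 in L2].

Fixpoint lang_exp (L : language) (n : nat) : language :=
  if n is n'.+1 then lang_cat L (lang_exp L n') else [set [::]].

Definition lang_star (L : language) : language :=
  \bigcup_(n in [set: nat]) lang_exp L n.

Inductive regular : language -> Prop :=
| regular_empty : regular set0
| regular_letter (a : Sigma) : regular [set [:: a]]
| regular_union (L1 L2 : language) :
    regular L1 -> regular L2 -> regular (L1 `|` L2)
| regular_cat (L1 L2 : language) :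
    regular L1 -> regular L2 -> regular (lang_cat L1 L2)
| regular_star (L : language) : regular L -> regular (lang_star L).

(* Edges form a type of their own: parallel edges are allowed, and finiteness of
   the edge set is a separate requirement, since Sigma may be infinite. *)
Record automaton := Automaton {
  vertex : Type;
  edge : Type;
  source : edge -> vertex;
  target : edge -> vertex;
  label : edge -> Sigma;
  initial : set vertex;
  accepting : set vertex
}.

Definition finite_automaton (A : automaton) : Prop :=
  finite_set [set: vertex A] /\ finite_set [set: edge A].

Fixpoint is_path (A : automaton) (x : vertex A) (p : seq (edge A))
    (y : vertex A) : Prop :=
  if p is e :: p' then source e = x /\ is_path (target e) p' y else x = y.

Definition recognizes_word (A : automaton) (w : seq Sigma) : Prop :=
  exists (x y : vertex A) (p : seq (edge A)),
    [/\ initial x, accepting y, is_path x p y & map (@label A) p = w].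

Definition recognized_language (A : automaton) : language :=
  [set w | recognizes_word A w].

End Languages.

(* Main.v *)
From Stdlib Require List.
Require Import Defs.
From mathcomp Require Import all_boot.
From mathcomp Require Import boolp classical_sets cardinality.

(** The proof is that of the Myhill-Nerode theorem: the states of the automaton
are the left quotients [w^-1 L = {v | w ++ v in L}] of the language, reading a
letter [a] leads from a quotient [M] to [a^-1 M], the initial state is [L]
itself, and a state accepts when it contains the empty word. Reading [w] from
[M] leads to [w^-1 M], so the automaton recognizes [L]
([recognized_quotient_automaton]).

The automaton is finite as soon as [L] has finitely many quotients. As the
alphabet may be infinite, there is moreover an edge only for each of the letters
that occur in some word of [L], and these must be finitely many. Both conditions
are preserved by the regular operations. For the letters this is immediate. For
the quotients, take a factorization of [w ++ v] witnessing that this word lies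
in a concatenation or in a star, and look at the factor in which [w] ends: the
rest of this factor lies in a quotient of its language by a suffix of [w], and
what follows is independent of [w]. Thus [w^-1 (L1 L2)] is the union of
[(w^-1 L1) L2] and of some quotients of [L2] ([quotient_cat]), and, for [w]
nonempty, the quotient by [w] of the star of [L] is the union of some [N] in a
set of quotients of [L], each followed by the star of [L] ([quotient_star]). In
both cases the quotient is determined by elements and subsets of finite sets. *)

Set Implicit Arguments.
Unset Strict Implicit.
Unset Printing Implicit Defensive.

Local Open Scope classical_set_scope.

(** Every subset of an enumerated set is selected by a mask on the enumeration,
and there are finitely many masks of a given length. *)
Lemma finite_set_subsets (T : Type) (A : set T) :
  finite_set A -> finite_set [set S : set T | S `<=` A].
Proof.
move=> /(@finite_seqP {classic T}) [s ->].
pose select (m : (size s).-tuple bool) : set {classic T} := [set` mask m s].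
apply: (@sub_finite_set _ _ (select @` setT)); last first.
  exact/finite_image/finite_finset.
move=> S /= sSA; exists (map_tuple (fun x => `[< S x >]) (in_tuple s)) => //.
apply/seteqP; split=> x; rewrite /select /= -filter_mask mem_filter.
  by case/andP=> /asboolP.
by move=> Sx; apply/andP; split; [exact/asboolP | exact: sSA].
Qed.

Lemma finite_setT_sig (T : Type) (A : set T) :
  finite_set A -> finite_set [set: {x | A x}].
Proof.
move=> /(@finite_preimage {x | A x} _ _ sval) fA.
apply: sub_finite_set (fA _); first by move=> x _; exact: (svalP x).
by move=> [x Ax] [y Ay] _ _ /= xy; exact: eq_exist.
Qed.

Section Quotients.
Variable Sigma : Type.
Implicit Types (L M N : language Sigma) (u v w : seq Sigma).

Definition quotient L w : language Sigma := [set v | L (w ++ v)].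

Definition quotients L : set (language Sigma) := range (quotient L).

Definition letters L : set Sigma := [set a | exists2 w, L w & List.In a w].

Lemma quotient_quotient L u w : quotient (quotient L u) w = quotient L (u ++ w).
Proof. by apply/funext => v; rewrite /quotient /= catA. Qed.

Lemma quotients_self L : quotients L L.
Proof. by exists [::]. Qed.

Lemma quotients_step L M a :
  quotients L M -> quotients L (quotient M [:: a]).
Proof. by case=> u _ <-; exists (u ++ [:: a]); rewrite ?quotient_quotient. Qed.

Lemma letters_quotient L M a v : quotients L M -> M (a :: v) -> letters L a.
Proof.
case=> u _ <- Luav; exists (u ++ a :: v) => //.
by apply/List.in_app_iff; right; left.
Qed.

(** * Quotients of the regular operations *)

(** Two factorizations of one word: one of the two cuts comes first. *)
Lemma cat_eq_cat w v u1 u2 : w ++ v = u1 ++ u2 ->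
  (exists2 x, u1 = w ++ x & v = x ++ u2) \/
  (exists2 y, w = u1 ++ y & u2 = y ++ v).
Proof.
elim: w u1 => [|a w IHw] [|b u1] /=.
- by move=> ->; left; exists [::].
- by move=> ->; left; exists (b :: u1).
- by move=> <-; right; exists (a :: w).
- case=> <- /IHw[[x -> ->]|[y -> ->]]; first by left; exists x.
  by right; exists y.
Qed.

Definition suffixes_after L w : set (seq Sigma) :=
  [set y | exists2 u, L u & w = u ++ y].

Lemma quotient_cat L1 L2 w :
  quotient (lang_cat L1 L2) w =
    lang_cat (quotient L1 w) L2 `|`
    \bigcup_(N in [set quotient L2 y | y in suffixes_after L1 w]) N.
Proof.
apply/seteqP; split=> v.
  move=> [u1 Lu1 [u2 Lu2]] /esym/cat_eq_cat[[x u1E vE]|[y wE u2E]].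
    left; exists x; first by rewrite /quotient /= -u1E.
    by exists u2.
  right; exists (quotient L2 y); first by exists y => //; exists u1.
  by rewrite /quotient /= -u2E.
case=> [[x Lwx [u2 Lu2 <-]]|[_ [y [u Lu ->] <-] Lyv]].
  by exists (w ++ x) => //; exists u2 => //; rewrite catA.
by exists u => //; exists (y ++ v) => //; rewrite catA.
Qed.

Lemma lang_star_nil L : lang_star L [::].
Proof. by exists 0. Qed.

Lemma lang_star_cons L u v : L u -> lang_star L v -> lang_star L (u ++ v).
Proof.
by move=> Lu [n _ Lv]; exists n.+1 => //; exists u => //; exists v.
Qed.

Lemma lang_star_cat L u v :
  lang_star L u -> lang_star L v -> lang_star L (u ++ v).
Proof.
case=> n _; elim: n u => [|n IHn] u /=; first by move=> ->.
case=> u1 Lu1 [u2 Lu2 <-] Lv; rewrite -catA.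
by apply: lang_star_cons => //; exact: IHn.
Qed.

(** The factor of [w ++ v] that is singled out is the one containing the last
letter of [w], which is why [w] has to be nonempty. *)
Lemma lang_star_split L w v : w <> [::] -> lang_star L (w ++ v) ->
  exists u y, [/\ lang_star L u, w = u ++ y &
    lang_cat (quotient L y) (lang_star L) v].
Proof.
move=> w0 [n _]; elim: n w w0 => [|n IHn] w w0 /=.
  by case: w w0.
case=> u1 Lu1 [u2 Lu2 /esym/cat_eq_cat[[x u1E ->]|[y wE u2E]]].
  exists [::], w; split=> //; first exact: lang_star_nil.
  exists x; first by rewrite /quotient /= -u1E.
  by exists u2 => //; exists n.
have [y0|y0] := pselect (y = [::]).
  (* [w] ends exactly at a cut: its last factor must be the one singled out,
     as the induction hypothesis says nothing of the empty word. *)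
  move: wE u2E; rewrite y0 cats0 /= => wE u2E.
  exists [::], w; split=> //; first exact: lang_star_nil.
  exists [::]; first by rewrite /quotient /= cats0 wE.
  by exists v => //; exists n => //; rewrite -u2E.
have [|u [z [Lu yE Lv]]] := IHn y y0; first by rewrite -u2E.
exists (u1 ++ u), z; split=> //; first exact: lang_star_cons.
by rewrite wE yE catA.
Qed.

Lemma quotient_star L w : w <> [::] ->
  quotient (lang_star L) w =
    \bigcup_(N in [set quotient L y | y in suffixes_after (lang_star L) w])
      lang_cat N (lang_star L).
Proof.
move=> w0; apply/seteqP; split=> v.
  case/(lang_star_split w0) => u [y [Lu wE Lv]].
  by exists (quotient L y) => //; exists y => //; exists u.
case=> _ [y [u Lu ->] <-] [x Lyx [t Lt <-]].
rewrite /quotient /= -catA catA -catA; apply: lang_star_cat => //.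
by rewrite catA; exact: lang_star_cons.
Qed.

(** * Finiteness for regular languages *)

Lemma finite_quotients_letter a : finite_set (quotients [set [:: a]]).
Proof.
apply: (@sub_finite_set _ _
  ([set [set [:: a]]] `|` ([set [set [::]]] `|` [set set0]))).
  move=> _ [[|b w] _ <-]; first by left.
  right; case: (pselect (b :: w = [:: a])) => [->|bwa].
    left; apply/seteqP; split=> v /=; first by case.
    by rewrite /quotient /= => ->.
  right; apply/seteqP; split=> // v /= [ba wv].
  by apply: bwa; case: w wv => [|//]; rewrite ba.
by rewrite !finite_setU; do !split; exact: finite_set1.
Qed.

Lemma finite_quotients_cat L1 L2 :
  finite_set (quotients L1) -> finite_set (quotients L2) ->
  finite_set (quotients (lang_cat L1 L2)).
Proof.
move=> fL1 /finite_set_subsets fL2.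
pose rebuild M (S : set (language Sigma)) :=
  lang_cat M L2 `|` \bigcup_(N in S) N.
apply: sub_finite_set (finite_image2 rebuild fL1 fL2).
move=> _ [w _ <-]; rewrite quotient_cat.
exists (quotient L1 w); first by exists w.
by eexists; last reflexivity; move=> _ [y _ <-]; exists y.
Qed.

Lemma finite_quotients_star L :
  finite_set (quotients L) -> finite_set (quotients (lang_star L)).
Proof.
move=> /finite_set_subsets fL.
pose rebuild (S : set (language Sigma)) :=
  \bigcup_(N in S) lang_cat N (lang_star L).
apply: (@sub_finite_set _ _
  ([set lang_star L] `|` (rebuild @` [set S | S `<=` quotients L]))).
  move=> _ [w _ <-]; have [->|w0] := pselect (w = [::]); first by left.
  right; rewrite quotient_star //.
  by eexists; last reflexivity; move=> _ [y _ <-]; exists y.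
by rewrite finite_setU; split; [exact: finite_set1 | exact: finite_image].
Qed.

Lemma finite_quotients_regular L : regular L -> finite_set (quotients L).
Proof.
elim=> {L} [|a|L1 L2 _ fL1 _ fL2|L1 L2 _ fL1 _ fL2|L _ fL].
- by apply: sub_finite_set (finite_set1 set0) => _ [w _ <-].
- exact: finite_quotients_letter.
- apply: sub_finite_set (finite_image2 setU fL1 fL2) => _ [w _ <-].
  exists (quotient L1 w); first by exists w.
  by exists (quotient L2 w); first by exists w.
- exact: finite_quotients_cat.
- exact: finite_quotients_star.
Qed.

Lemma letters_cat L1 L2 :
  letters (lang_cat L1 L2) `<=` letters L1 `|` letters L2.
Proof.
move=> a [_ [u Lu [v Lv <-]]] /List.in_app_iff[au|av].
  by left; exists u.
by right; exists v.
Qed.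

Lemma letters_star L : letters (lang_star L) `<=` letters L.
Proof.
move=> a [w [n _ Lw] aw]; elim: n w Lw aw => [|n IHn] w /=; first by move=> ->.
case=> u Lu [v Lv <-] /List.in_app_iff[au|av]; first by exists u.
exact: IHn av.
Qed.

Lemma finite_letters_regular L : regular L -> finite_set (letters L).
Proof.
elim=> {L} [|a|L1 L2 _ fL1 _ fL2|L1 L2 _ fL1 _ fL2|L _ fL].
- by apply: sub_finite_set (finite_set0 Sigma) => a [].
- by apply: sub_finite_set (finite_set1 a) => b [_ -> []].
- apply: (@sub_finite_set _ _ (letters L1 `|` letters L2)).
    by move=> a [w [Lw|Lw] aw]; [left|right]; exists w.
  by rewrite finite_setU.
- apply: sub_finite_set (@letters_cat _ _) _.
  by rewrite finite_setU.
- exact: sub_finite_set (@letters_star _) fL.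
Qed.

(** * The automaton of quotients *)

Definition quotient_automaton L : automaton Sigma :=
  @Automaton Sigma
    {M | quotients L M} ({M | quotients L M} * {a | letters L a})
    fst
    (fun e => exist _ _ (quotients_step (sval e.2) (svalP e.1)))
    (fun e => sval e.2)
    [set x | sval x = L]
    [set x | sval x [::]].

Lemma finite_quotient_automaton L :
  finite_set (quotients L) -> finite_set (letters L) ->
  finite_automaton (quotient_automaton L).
Proof.
move=> /finite_setT_sig fQ /finite_setT_sig fS; split=> //.
by apply: sub_finite_set (finite_setX fQ fS) => -[].
Qed.

Lemma path_quotient L (x y : vertex (quotient_automaton L)) p :
  is_path x p y -> sval y = quotient (sval x) (map (@label _ _) p).
Proof.
elim: p x => [|e p IHp] x /=; first by move=> ->.
by case=> <- /IHp ->; rewrite /= quotient_quotient.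
Qed.

(** A word of the language of a state never gets stuck: the letters read are
letters of [L], so they label edges. *)
Lemma quotient_path L (x : vertex (quotient_automaton L)) w :
  sval x w -> exists y p,
    [/\ is_path x p y, sval y [::] &
        map (@label _ (quotient_automaton L)) p = w].
Proof.
elim: w x => [|a w IHw] x xw; first by exists x, [::].
have La := letters_quotient (svalP x) xw.
pose e : edge (quotient_automaton L) := (x, exist _ a La).
have [|y [p [pth ynil pw]]] := IHw (target e); first exact: xw.
by exists y, (e :: p); split=> //=; rewrite pw.
Qed.

Lemma recognized_quotient_automaton L :
  recognized_language (quotient_automaton L) = L.
Proof.
apply/seteqP; split=> w.
  case=> x [y [p [xL ynil /path_quotient yE pw]]].
  by move: ynil; rewrite /= yE xL pw /quotient /= cats0.
move=> Lw.
pose x : vertex (quotient_automaton L) := exist _ L (quotients_self L).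
have [y [p [pth ynil pw]]] := @quotient_path L x w Lw.
by exists x, y, p.
Qed.

End Quotients.

Theorem theorem40 (Sigma : Type) (L : language Sigma) (hL : regular L) :
  exists A : automaton Sigma,
    finite_automaton A /\ recognized_language A = L.
Proof.
exists (quotient_automaton L); split; last exact: recognized_quotient_automaton.
apply: finite_quotient_automaton.
  exact: finite_quotients_regular.
exact: finite_letters_regular.
Qed.
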